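(* In the prediction space setting, suppose that $k\ge 2$ and consider any linearly combined probabilistic forecast $F=\sum_{i=1}^k w_iF_i$ with weights $w_1,\dots,w_k$ that are strictly positive and sum to $1$. For $i\ne j$, suppose that $F_i\ne F_j$ with positive probability. Then the following holds: (a) The linearly combined forecast $F$ is at least as dispersed as the least dispersed of the components $F_1,\dots,F_k$, that is, $\operatorname{var}(Z_F)\le\max_{1\le i\le k}\operatorname{var}(Z_{F_i})$. (b) If the component forecasts $F_1,\dots,F_k$ are regular, then $F$ is more dispersed than the least dispersed of the components, that is, $\operatorname{var}(Z_F)<\max_{1\le i\le k}\operatorname{var}(Z_{F_i})$. (c) If the components $F_1,\dots,F_k$ are neutrally dispersed and regular, then $F$ is overdispersed.
   Context: A prediction space is a probability space $(\Omega,\mathcal{A},\mathbb{Q})$ with sub-$\sigma$-algebras $\mathcal{A}_1,\dots,\mathcal{A}_k\subseteq\mathcal{A}$ carrying: for $i=1,\dots,k$, a random right-continuous cumulative distribution function (CDF-valued random quantity) $F_i$ on $\mathbb{R}$ that is $\mathcal{A}_i$-measurable (i.e. $F_i(x)$ is $\mathcal{A}_i$-measurable for each $x\in\mathbb{R}$); a real-valued random variable $Y$ (the observation); and a random variable $V$ uniformly distributed on the unit interval and independent of $\mathcal{A}_1,\dots,\mathcal{A}_k$ and $Y$ (jointly). Probabilities and variances refer to $\mathbb{Q}$. The probability integral transform of a CDF-valued random quantity (forecast) $F$ is $Z_F=\lim_{y\uparrow Y}F(y)+V\bigl(F(Y)-\lim_{y\uparrow Y}F(y)\bigr)$, with the same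 $V$ used for all forecasts. $F$ is overdispersed if $\operatorname{var}(Z_F)<\frac1{12}$, neutrally dispersed if $\operatorname{var}(Z_F)=\frac1{12}$, and underdispersed if $\operatorname{var}(Z_F)>\frac1{12}$. $F$ is at least as dispersed as $G$ if $\operatorname{var}(Z_F)\le\operatorname{var}(Z_G)$, and more dispersed than $G$ if $\operatorname{var}(Z_F)<\operatorname{var}(Z_G)$. $F$ is regular if the support of the distribution of $Z_F$ is the unit interval $[0,1]$.
   Formalization: Parts (b) and (c) additionally assume that for some i, j, with positive probability, F_i and F_j differ at Y in value or in left limit; F_i ≠ F_j with positive probability alone does not give strict inequality, since all Z_{F_i} may coincide. *)

(* Defs.v *)
From HB Require Import structures.
From mathcomp Require Import all_boot all_order all_algebra.
From mathcomp Require Import all_classical all_reals all_analysis.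
Set Implicit Arguments.
Unset Strict Implicit.
Unset Printing Implicit Defensive.
Import Order.TTheory GRing.Theory Num.Theory.
Import numFieldNormedType.Exports.
Local Open Scope classical_set_scope.
Local Open Scope ring_scope.

Definition left_lim (R : realType) (G : R -> R) (x : R) : R :=
  lim (G y @[y --> x^'-]).

(* [F i w] is the i-th forecast at the sample point [w]; the library type
   [cumulativeBounded 0 1] consists of the nondecreasing right-continuous
   functions with limits 0 at -oo and 1 at +oo. *)
Record prediction_space d (T : measurableType d) (R : realType)
    (P : probability T R) (k : nat) (A : 'I_k -> set (set T))
    (F : 'I_k -> T -> cumulativeBounded (0 : R) (1 : R))
    (Y V : {RV P >-> R}) : Prop := PredictionSpace {
  ps_sigma_algebra : forall i, sigma_algebra [set: T] (A i) ;
  ps_sub_sigma_algebra : forall i, A i `<=` measurable ;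
  ps_adapted : forall i (x : R) (B : set R), measurable B ->
    A i ((fun w => F i w x) @^-1` B) ;
  ps_uniform : forall B : set R, measurable B ->
    distribution P V B = uniform_prob (@ltr01 R) B ;
  (* V is independent of the sigma-algebra generated jointly by
     A_1, ..., A_k and Y *)
  ps_independent : forall (B : set R) (C : set T), measurable B ->
    <<s \bigcup_i A i `|` [set Y @^-1` D | D in measurable] >> C ->
    P (V @^-1` B `&` C) = (P (V @^-1` B) * P C)%E }.
Arguments prediction_space {d T R} P {k} A F Y V.

Definition linear_pool (T : Type) (R : realType) (k : nat) (c : 'I_k -> R)
    (F : 'I_k -> T -> R -> R) : T -> R -> R :=
  fun w x => \sum_(i < k) c i * F i w x.

(* Probability integral transform of the forecast [G]. *)
Definition pit (T : Type) (R : realType) (Y V : T -> R) (G : T -> R -> R) :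
    T -> R :=
  fun w => left_lim (G w) (Y w)
           + V w * (G w (Y w) - left_lim (G w) (Y w)).

Definition overdispersed d (T : measurableType d) (R : realType)
    (P : probability T R) (Y V : T -> R) (G : T -> R -> R) : Prop :=
  ('V_P[pit Y V G] < (12%:R^-1)%:E)%E.

Definition neutrally_dispersed d (T : measurableType d) (R : realType)
    (P : probability T R) (Y V : T -> R) (G : T -> R -> R) : Prop :=
  'V_P[pit Y V G] = (12%:R^-1)%:E.

Definition measure_support (R : realType) (mu : set R -> \bar R) : set R :=
  [set x | forall U : set R, open U -> U x -> (0 < mu U)%E].

Definition regular d (T : measurableType d) (R : realType)
    (P : probability T R) (Y V : T -> R) (G : T -> R -> R) : Prop :=
  measure_support (pushforward P (pit Y V G)) = `[0, 1]%classic.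

(* Sample points at which two forecasts differ in a way visible at the
   observation, i.e. in the value or the left limit at Y.  That F_i <> F_j as
   functions with positive probability does not suffice for strict inequality
   of variances: take Y = 0 and a fair coin S independent of V; given S = 0 let
   F_1, F_2 put mass 1/2 at 0 and 1/2 at 1, 2 respectively, and given S = 1 let
   them put mass 1/2 at 0 and 1/2 at -1, -2 respectively.  Then F_1 <> F_2
   everywhere, yet the transforms of F_1, F_2 and of all their convex
   combinations are equal, namely (S + V) / 2, which is uniform on [0, 1]. *)
Definition differ_at (T : Type) (R : realType) (Y : T -> R)
    (G H : T -> R -> R) : set T :=
  [set w | G w (Y w) <> H w (Y w) \/
           left_lim (G w) (Y w) <> left_lim (H w) (Y w)].

(* Main.v *)
Require Import Defs.
From HB Require Import structures.
From mathcomp Require Import all_boot all_order all_algebra.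
From mathcomp Require Import all_classical all_reals all_analysis.
From mathcomp Require Import measurable_realfun ess_sup_inf.
From mathcomp Require Import ring lra.
Import Order.TTheory GRing.Theory Num.Theory.
Import numFieldNormedType.Exports.
Local Open Scope classical_set_scope.
Local Open Scope ring_scope.

(** The left limit of a linear pool is the pool of the left limits, so the
    transform of the pool is M = sum_i c_i Z_i, where the Z_i are the transforms
    of the components and the same V occurs in all of them. The transforms take
    values in [0, 1] almost surely, and for square integrable variables and
    weights of sum 1 the parallel axis identity reads

      var M = sum_i c_i var Z_i - sum_i c_i var (Z_i - M)

    ([variance_convex_comb]). The subtracted sum is nonnegative and a weighted
    mean is at most the maximum, which proves (a).

    The inequality is strict unless every Z_i - M is almost surely constant.
    In that case Z_i = Z_j + a almost surely, for each i and j and some constant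
    a. Translating a law translates its support, so regularity of F_i and F_j
    forces a = 0 ([regular_shift_eq0]). Now Z_i - Z_j = D + V J, where D is the
    difference of the left limits at Y and J the difference of the jumps at Y.
    Both are functions of the information generated by the A_i and Y, of which V
    is independent. As V has no atoms, D + V J = 0 almost surely only if
    D = J = 0 almost surely ([independent_affine_ae_eq0]), that is, if the values
    and the left limits of F_i and F_j at Y agree almost surely. Hence two
    visibly distinct components make the inequality strict, which proves (b);
    (c) is the case in which the weighted mean of the variances is 1/12. *)

Set Implicit Arguments.
Unset Strict Implicit.
Unset Printing Implicit Defensive.

(** * Left limits and right values of nondecreasing functions *)

Section left_limits.
Context {R : realType}.
Implicit Types G : cumulative R R.

Lemma cvg_left_lim G x : G y @[y --> x^'-] --> left_lim G x.
Proof.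
apply: (@nondecreasing_at_left_is_cvgr R G x).
- by near=> z => a b _ _; exact: cumulative_is_nondecreasing.
- near=> z; exists (G x) => _ /= [y + <-]; rewrite in_itv/= => /andP[_ yx].
  by apply: cumulative_is_nondecreasing; exact: ltW.
Unshelve. all: by end_near. Qed.

Lemma left_lim_ge G x y : y < x -> G y <= left_lim G x.
Proof.
move=> yx; apply: limr_ge; first exact: cvg_left_lim.
near=> z; apply: cumulative_is_nondecreasing.
by apply/ltW; near: z; exact: nbhs_left_gt.
Unshelve. all: by end_near. Qed.

Lemma left_lim_le G x : left_lim G x <= G x.
Proof.
apply: limr_le; first exact: cvg_left_lim.
near=> z; apply: cumulative_is_nondecreasing.
by apply/ltW; near: z; exact: nbhs_left_lt.
Unshelve. all: by end_near. Qed.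

(** With [cumulative_ltP], this turns strict inequalities at the point [x] into
    countable unions over the rationals. When [G] and [x] are random this yields
    the measurability of the value and of the left limit of [G] at [x], although
    [G] is only known to be measurable at each deterministic point. *)
Lemma left_lim_gtP G x t :
  t < left_lim G x <-> exists q : rat, ratr q < x /\ t < G (ratr q).
Proof.
split=> [tL|[q [qx tG]]]; last first.
  by rewrite (lt_le_trans tG)// left_lim_ge.
have [y [yx tGy]] : exists y, y < x /\ t < G y.
  have near_gt := cvgr_gt _ (@cvg_left_lim G x) _ tL.
  near x^'- => y; exists y; split; near: y; last exact: near_gt.
  exact: nbhs_left_lt.
have [q] := rat_in_itvoo yx; rewrite in_itv/= => /andP[yq qx].
exists q; split => //; apply: lt_le_trans tGy _.
exact/cumulative_is_nondecreasing/ltW.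
Unshelve. all: by end_near. Qed.

Lemma cumulative_ltP G x t :
  G x < t <-> exists q : rat, x < ratr q /\ G (ratr q) < t.
Proof.
split=> [Gt|[q [xq Gt]]]; last first.
  by apply: le_lt_trans Gt; exact/cumulative_is_nondecreasing/ltW.
have [y [xy Gyt]] : exists y, x < y /\ G y < t.
  have near_lt := cvgr_lt _ (cumulative_is_right_continuous G x) _ Gt.
  near x^'+ => y; exists y; split; near: y; last exact: near_lt.
  exact: nbhs_right_gt.
have [q] := rat_in_itvoo xy; rewrite in_itv/= => /andP[xq qy].
exists q; split => //; apply: le_lt_trans Gyt.
exact/cumulative_is_nondecreasing/ltW.
Unshelve. all: by end_near. Qed.

End left_limits.

Section bounded_cumulative.
Context {R : realType} (l r : R) (G : cumulativeBounded l r).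

Lemma cumulativeBounded_ge x : l <= G x.
Proof.
have cG : cvg (G y @[y --> -oo]) by apply/cvg_ex; exists l; exact: cumulativeNy.
suff : lim (G y @[y --> -oo]) <= G x by rewrite (cvg_lim _ (cumulativeNy G)).
apply: limr_le => //; near=> y; apply: cumulative_is_nondecreasing; near: y.
exact: nbhs_ninfty_le.
Unshelve. all: by end_near. Qed.

Lemma cumulativeBounded_le x : G x <= r.
Proof.
have cG : cvg (G y @[y --> +oo]) by apply/cvg_ex; exists r; exact: cumulativey.
suff : G x <= lim (G y @[y --> +oo]) by rewrite (cvg_lim _ (cumulativey G)).
apply: limr_ge => //; near=> y; apply: cumulative_is_nondecreasing; near: y.
exact: nbhs_pinfty_ge.
Unshelve. all: by end_near. Qed.

Lemma left_lim_cumulativeBounded_ge x : l <= left_lim G x.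
Proof.
by rewrite (le_trans (cumulativeBounded_ge (x - 1)))// left_lim_ge// gtrBl.
Qed.

End bounded_cumulative.

Section random_cumulative.
Context d (T : measurableType d) (R : realType).
Variables (G : T -> cumulative R R) (Y : T -> R).
Hypothesis mG : forall x, measurable_fun setT (G ^~ x).
Hypothesis mY : measurable_fun setT Y.

Lemma measurable_cumulative_at : measurable_fun setT (fun w => G w (Y w)).
Proof.
move=> mT; apply: (measurability _ (RGenInftyO.measurableE R)) => //.
move=> _ [_ [t ->] <-]; rewrite setTI.
rewrite (_ : _ @^-1` _ = \bigcup_(q : rat)
    ([set w | Y w < ratr q] `&` [set w | G w (ratr q) < t])); last first.
  apply/seteqP; split=> w /=; rewrite in_itv/=.
    by move/cumulative_ltP => [q [? ?]]; exists q.
  by move=> [q _ [? ?]]; apply/cumulative_ltP; exists q.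
apply: bigcupT_measurable_rat => q; apply: measurableI.
  by rewrite -[X in measurable X]setTI; apply: measurable_fun_ltr.
by rewrite -[X in measurable X]setTI; apply: measurable_fun_ltr.
Qed.

Lemma measurable_left_lim_at :
  measurable_fun setT (fun w => left_lim (G w) (Y w)).
Proof.
move=> mT; apply: (measurability _ (RGenOInfty.measurableE R)) => //.
move=> _ [_ [t ->] <-]; rewrite setTI.
rewrite (_ : _ @^-1` _ = \bigcup_(q : rat)
    ([set w | ratr q < Y w] `&` [set w | t < G w (ratr q)])); last first.
  apply/seteqP; split=> w /=; rewrite in_itv/= andbT.
    by move/left_lim_gtP => [q [? ?]]; exists q.
  by move=> [q _ [? ?]]; apply/left_lim_gtP; exists q.
apply: bigcupT_measurable_rat => q; apply: measurableI.
  by rewrite -[X in measurable X]setTI; apply: measurable_fun_ltr.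
by rewrite -[X in measurable X]setTI; apply: measurable_fun_ltr.
Qed.

End random_cumulative.

(** * The transform of a linear pool *)

Section pooling.
Context {T : Type} {R : realType} {k : nat} (c : 'I_k -> R).
Variable F : 'I_k -> T -> cumulative R R.
Let pool := linear_pool c (fun i w => F i w : R -> R).

Lemma left_lim_linear_pool w x :
  left_lim (pool w) x = \sum_(i < k) c i * left_lim (F i w) x.
Proof.
apply: cvg_lim => //; apply: cvg_big => [|i _]; first exact: add_continuous.
by apply: cvgMr; exact: cvg_left_lim.
Qed.

Lemma pit_linear_pool (Y V : T -> R) :
  pit Y V pool = \sum_(i < k) c i *: pit Y V (fun w => F i w : R -> R).
Proof.
apply/funext => w; rewrite /pit left_lim_linear_pool fct_sumE.
rewrite /pool /linear_pool -sumrB mulr_sumr -big_split/=; apply: eq_bigr => i _.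
rewrite fctE /GRing.scale/=; ring.
Qed.

End pooling.

(** * Variance of a convex combination *)

Section second_order.
Context d (T : measurableType d) (R : realType) (P : probability T R).
Implicit Types X Z : T -> R.

Let Pfin : P setT \is a fin_num := fin_num_measure P _ measurableT.

Lemma ae_bounded_Lfun2 X (M : R) : measurable_fun setT X ->
  {ae P, forall w, `|X w| <= M} -> X \in Lfun P 2%:E.
Proof.
move=> mX Xb; have p1 : (1 <= 2%:E :> \bar R)%E by rewrite lee_fin ler1n.
have q1 : (1 <= +oo :> \bar R)%E by rewrite leey.
apply: (Lfun_subset p1 q1 Pfin (leey _)).
rewrite inE; apply/andP; split; rewrite inE//=.
rewrite /finite_norm unlock /Lnorm; case: ifPn => // _.
apply: (@le_lt_trans _ _ M%:E); last exact: ltry.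
by apply/ess_supP; apply: filterS Xb => w /=; rewrite lee_fin.
Qed.

Lemma Lfun2_scale (a : R) X : X \in Lfun P 2%:E -> a *: X \in Lfun P 2%:E.
Proof.
move=> X2; rewrite (_ : a *: X = a \o* X); first by rewrite Lfun_scale ?ler1n.
by apply/funext => w; rewrite /= mulrC.
Qed.

Lemma covarianceZ_l (a : R) X Z : X \in Lfun P 2%:E -> Z \in Lfun P 2%:E ->
  covariance P (a *: X) Z = (a%:E * covariance P X Z)%E.
Proof.
move=> X2 Z2; have L12 U : U \in Lfun P 2%:E -> U \in Lfun P 1.
  exact: Lfun_subset12.
rewrite (_ : a *: X = a \o* X); last by apply/funext => w; rewrite /= mulrC.
by rewrite covarianceZl ?Lfun2_mul_Lfun1// L12.
Qed.

Lemma Lfun2_lincomb (I : Type) (r : seq I) (c : I -> R) (X : I -> T -> R) :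
  (forall i, X i \in Lfun P 2%:E) ->
  \sum_(i <- r) c i *: X i \in Lfun P 2%:E.
Proof.
move=> X2; elim: r => [|i r IH]; first by rewrite big_nil Lfun_cst.
rewrite big_cons; apply: rpredD => [|p1|p1]; first by rewrite lee1n.
  exact: Lfun2_scale.
exact: IH.
Qed.

Lemma covariance_lincomb (I : Type) (r : seq I) (c : I -> R)
    (X : I -> T -> R) Z :
  (forall i, X i \in Lfun P 2%:E) -> Z \in Lfun P 2%:E ->
  covariance P (\sum_(i <- r) c i *: X i) Z =
  (\sum_(i <- r) (c i)%:E * covariance P (X i) Z)%E.
Proof.
move=> X2 Z2; elim: r => [|i r IH].
  by rewrite !big_nil (_ : 0 = cst 0)// covariance_cst_l.
have S2 := Lfun2_lincomb r c X2.
rewrite !big_cons -IH covarianceDl ?Lfun2_scale//.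
by rewrite covarianceZ_l.
Qed.

(** The parallel axis identity: writing M for the combination,
    var (X_i - M) = var X_i + var M - 2 cov (X_i, M), and the weighted mean of
    the covariances cov (X_i, M) is cov (M, M) = var M. *)
Lemma variance_convex_comb k (c : 'I_k -> R) (X : 'I_k -> T -> R) :
  (forall i, X i \in Lfun P 2%:E) -> \sum_(i < k) c i = 1 ->
  let M := \sum_(i < k) c i *: X i in
  fine 'V_P[M] = \sum_(i < k) c i * fine 'V_P[X i]
                 - \sum_(i < k) c i * fine 'V_P[(X i \- M)].
Proof.
move=> X2 c1 M; have M2 : M \in Lfun P 2%:E by exact: Lfun2_lincomb.
have covfin i : covariance P (X i) M \is a fin_num.
  by rewrite covariance_fin_num ?Lfun2_mul_Lfun1//; exact: Lfun_subset12.
have VM : \sum_(i < k) c i * fine (covariance P (X i) M) = fine 'V_P[M].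
  rewrite /variance {3}/M covariance_lincomb// -sum_fine//; last first.
    by move=> i _; rewrite fin_numM.
  by apply: eq_bigr => i _; rewrite fineM.
have VD i : fine 'V_P[(X i \- M)] =
    fine 'V_P[X i] + fine 'V_P[M] - 2 * fine (covariance P (X i) M).
  rewrite varianceB//; have VX := variance_fin_num (X2 i).
  have VMf := variance_fin_num M2.
  by rewrite fineB ?fineD ?fineM// ?fin_numD ?VX ?fin_numM.
under [X in _ - X]eq_bigr do rewrite VD mulrBr mulrDr mulrCA.
rewrite sumrB big_split/= -mulr_suml c1 mul1r -mulr_sumr VM.
ring.
Qed.

Lemma variance_eq0_ae X : X \in Lfun P 2%:E -> 'V_P[X] = 0%E ->
  {ae P, forall w, X w = fine 'E_P[X]}.
Proof.
move=> X2; rewrite /variance unlock; set m := fine _.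
have mX : measurable_fun setT X by move: X2; rewrite inE => /andP[/[!inE]].
rewrite unlock => V0.
have mS : measurable_fun setT
    (fun w => (((X \- cst m) * (X \- cst m)) w)%:E).
  by apply/measurable_EFinP; apply: measurable_funM; exact: measurable_funB.
have {}V0 : (\int[P]_w `|(((X \- cst m) * (X \- cst m)) w)%:E| = 0)%E.
  rewrite -[RHS]V0; apply: eq_integral => w _.
  by rewrite gee0_abs// lee_fin -expr2 sqr_ge0.
have := (ae_eq_integral_abs P measurableT mS).1 V0.
apply: filterS => w /(_ Logic.I) [] /eqP.
by rewrite -expr2 sqrf_eq0 subr_eq0 => /eqP.
Qed.

End second_order.

(** * Translation of the support of a law *)

Section ae_inclusion.
Context d (T : measurableType d) (R : realType) (P : probability T R).

Lemma ae_le_measure (A B : set T) : measurable A -> measurable B ->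
  {ae P, forall w, A w -> B w} -> (P A <= P B)%E.
Proof.
move=> mA mB [N [mN N0 AB]]; rewrite -(measureU0 mB mN N0).
apply: le_measure; rewrite ?inE//; first exact: measurableU.
move=> w Aw; have [?|nN] := pselect (N w); [by right|left].
by apply: contrapT => nB; apply: nN; apply: AB => /(_ Aw).
Qed.

End ae_inclusion.

Section support.
Context d (T : measurableType d) (R : realType) (P : probability T R).

Lemma measure_support_shift (U W : T -> R) (a x : R) :
  measurable_fun setT U -> measurable_fun setT W ->
  {ae P, forall w, U w = W w + a} ->
  measure_support (pushforward P W) x ->
  measure_support (pushforward P U) (x + a).
Proof.
move=> mU mW UW Wx O oO Oxa.
have mpre (f : T -> R) B : measurable_fun setT f -> open B ->
    measurable (f @^-1` B).
  move=> mf oB; rewrite -[_ @^-1` _]setTI; apply: mf => //.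
  exact: open_measurable.
have oO' : open [set y | O (y + a)].
  apply: (@open_comp _ _ (fun y => y + a)) => // y _.
  by apply: continuousD; [exact: cvg_id|exact: cst_continuous].
apply: lt_le_trans (Wx _ oO' Oxa) _; rewrite /pushforward.
apply: ae_le_measure; [exact: mpre|exact: mpre|].
by apply: filterS UW => w /= ->.
Qed.

(** The interval [0, 1] would have to contain its own translate by [a]: the
    image of 1 shows that [a <= 0] and the image of 0 that [0 <= a]. *)
Lemma regular_shift_eq0 (U W : T -> R) (a : R) :
  measurable_fun setT U -> measurable_fun setT W ->
  {ae P, forall w, U w = W w + a} ->
  measure_support (pushforward P U) = `[0, 1]%classic ->
  measure_support (pushforward P W) = `[0, 1]%classic -> a = 0.
Proof.
move=> mU mW UW sU sW.
have shift x := @measure_support_shift U W a x mU mW UW.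
have := shift 0; have := shift 1; rewrite sU sW /= !in_itv/= !lexx ler01/=.
move=> /(_ isT)/andP[_ a1] /(_ isT)/andP[a0 _].
by apply/eqP; rewrite eq_le; apply/andP; split; lra.
Qed.

End support.

(** * A uniform variable independent of a sigma-algebra *)

Section uniform.
Context d (T : measurableType d) (R : realType) (P : probability T R).
Variable V : {RV P >-> R}.
Hypothesis V_uniform : forall B : set R, measurable B ->
  distribution P V B = uniform_prob (@ltr01 R) B.

Lemma uniform_ae_itv : {ae P, forall w, 0 <= V w <= 1}.
Proof.
exists (V @^-1` ~` `[0, 1]%classic); split.
- rewrite -[X in measurable X]setTI; apply: measurable_funP => //.
  exact: measurableC.
- rewrite -[LHS]/(distribution P V (~` `[0, 1]%classic)).
  rewrite V_uniform; last exact: measurableC.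
  by rewrite /uniform_prob integral_uniform_pdf setICl integral_set0.
- by move=> w /=; rewrite in_itv.
Qed.

Lemma uniform_lt_half : P (V @^-1` `]-oo, 2^-1[%classic) = (2^-1)%:E.
Proof.
rewrite -[LHS]/(distribution P V `]-oo, 2^-1[%classic) V_uniform//.
rewrite /uniform_prob integral_uniform_pdf.
rewrite (_ : _ `&` _ = `[0, 2^-1[%classic); last first.
  apply/seteqP; split=> x /=; rewrite !in_itv/=.
    by move=> [xh /andP[->]].
  by move=> /andP[x0 xh]; split=> //; apply/andP; split=> //; lra.
rewrite (eq_integral (fun=> 1%E)); last first.
  move=> x; rewrite inE/= in_itv/= /uniform_pdf => /andP[x0 xh].
  by rewrite x0/= (_ : x <= 1) ?subr0 ?invr1//; lra.
rewrite integral_cst// mul1e.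
have /= := @lebesgue_measure_itv R `[0, 2^-1[.
by rewrite lte_fin invr_gt0 ltr0n oppr0 adde0 => ->.
Qed.

(** Where [b != 0], the equation determines [V = - a / b], so the event
    [V < 1/2] almost surely coincides there with an event [H] of the
    sigma-algebra.
    Independence of [V] from [D = {b != 0}] gives P(H) = P(D) / 2, and
    independence from [H] gives P(H) = P(H) / 2. Hence P(D) = 0. *)
Lemma independent_affine_ae_eq0 (S : set (set T)) (a b : T -> R) :
  <<s S >> `<=` measurable ->
  (forall B C, measurable B -> <<s S >> C ->
    P (V @^-1` B `&` C) = (P (V @^-1` B) * P C)%E) ->
  measurable_fun setT (a : g_sigma_algebraType S -> R) ->
  measurable_fun setT (b : g_sigma_algebraType S -> R) ->
  {ae P, forall w, a w + V w * b w = 0} ->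
  {ae P, forall w, a w = 0 /\ b w = 0}.
Proof.
move=> Sm indep ma mb ab0.
pose D := [set w | b w != 0].
(* On D, - a / b < 1/2 reads 0 < 2 a b + b^2 once multiplied by 2 b^2. *)
pose H := D `&` [set w | 0 < 2 * (a w * b w) + b w ^+ 2].
have SD : <<s S >> D.
  have -> : D = (b : g_sigma_algebraType S -> R) @^-1` [set~ 0].
    by apply/seteqP; split=> w /= /eqP.
  by have := mb measurableT [set~ 0]; rewrite setTI; apply; exact: measurableC.
have SH : <<s S >> H.
  have mpoly : measurable_fun setT
      ((fun w => 2 * (a w * b w) + b w ^+ 2) : g_sigma_algebraType S -> R).
    apply: measurable_funD; last exact: measurable_funX.
    by apply: measurable_funM => //; exact: measurable_funM.
  apply: (@measurableI _ (g_sigma_algebraType S)) => //.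
  have := mpoly measurableT `]0, +oo[%classic; rewrite setTI.
  have <- : [set w | 0 < 2 * (a w * b w) + b w ^+ 2] =
    ((fun w => 2 * (a w * b w) + b w ^+ 2) : g_sigma_algebraType S -> R)
      @^-1` `]0, +oo[%classic.
    by apply/seteqP; split=> w /=; rewrite in_itv/= andbT.
  by apply.
pose E := V @^-1` `]-oo, 2^-1[%classic.
have mE : measurable E.
  by rewrite -[E]setTI; apply: measurable_funP => //; exact: measurableT.
have mD := Sm _ SD; have mH := Sm _ SH.
have key w : a w + V w * b w = 0 -> (E `&` D) w <-> H w.
  move=> abw; rewrite /E/= in_itv/= /D/=.
  have aE : 2 * (a w * b w) + b w ^+ 2 = (1 - 2 * V w) * b w ^+ 2.
    have -> : a w = - (V w * b w) by lra.
    ring.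
  rewrite /H/= aE; split=> [[Vh bn0]|[bn0 +]].
    by split=> //; rewrite mulr_gt0 ?exprn_even_gt0//; lra.
  by rewrite pmulr_lgt0 ?exprn_even_gt0// => Vh; split=> //; lra.
have aeEDH : {ae P, forall w, (E `&` D) w <-> H w} by apply: filterS ab0.
have mED : measurable (E `&` D) by exact: measurableI.
have mEH : measurable (E `&` H) by exact: measurableI.
have PH1 : P H = ((2^-1)%:E * P D)%E.
  rewrite -uniform_lt_half -indep// -/E.
  apply/eqP; rewrite eq_le; apply/andP; split.
  - by apply: ae_le_measure => //; apply: filterS aeEDH => w [].
  - by apply: ae_le_measure => //; apply: filterS aeEDH => w [].
have PH2 : P H = ((2^-1)%:E * P H)%E.
  rewrite -[in RHS]uniform_lt_half -indep// -/E.
  apply/eqP; rewrite eq_le; apply/andP; split.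
  - apply: ae_le_measure => //.
    by apply: filterS aeEDH => w EDH Hw; split=> //; case: (EDH.2 Hw).
  - by apply: ae_le_measure => //; apply: nearW => w [].
have PD0 : P D = 0%E.
  have PDf := fin_num_measure P D mD; have PHf := fin_num_measure P H mH.
  move: PH1 PH2; rewrite -(fineK PDf) -(fineK PHf) -!EFinM => -[h1] [h2].
  by congr EFin; lra.
have aeD : {ae P, forall w, b w = 0} by exists D; split => // w /= /eqP.
by apply: filterS2 ab0 aeD => w abw bw; move: abw; rewrite bw mulr0 addr0.
Qed.

End uniform.

(** * Transforms in a prediction space *)

Section prediction_space.
Context d (T : measurableType d) (R : realType) (P : probability T R).
Context (k : nat) (A : 'I_k -> set (set T)).
Context (F : 'I_k -> T -> cumulativeBounded (0 : R) (1 : R)).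
Context (Y V : {RV P >-> R}).
Hypothesis hps : prediction_space P A F Y V.

(** The information of which V is independent is the sigma-algebra [<<s G>>].
    Measurability of the forecasts at Y is proved for it rather than for the
    whole space, since independence is applied to events defined by them. *)
Let G : set (set T) := \bigcup_i A i `|` [set Y @^-1` D | D in measurable].
Let Z i := pit Y V (fun w => F i w : R -> R).

Lemma information_measurable : <<s G >> `<=` measurable.
Proof.
apply: smallest_sub; first exact: sigma_algebra_measurable.
move=> B [[i _ AB]|[D mD <-]]; first exact: (ps_sub_sigma_algebra hps AB).
by rewrite -[X in measurable X]setTI; exact: measurable_funP.
Qed.

Lemma information_measurable_fun (f : T -> R) :
  measurable_fun setT (f : g_sigma_algebraType G -> R) -> measurable_fun setT f.
Proof.
move=> mf _ B mB; apply: information_measurable.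
exact: (mf measurableT).
Qed.

Let measurable_forecast i x :
  measurable_fun setT ((fun w => F i w x) : g_sigma_algebraType G -> R).
Proof.
move=> _ B mB; rewrite setTI; apply: sub_sigma_algebra; left.
by exists i => //; apply: (ps_adapted hps).
Qed.

Let measurable_observation :
  measurable_fun setT (Y : g_sigma_algebraType G -> R).
Proof.
move=> _ B mB; rewrite setTI; apply: sub_sigma_algebra; right.
by exists B.
Qed.

Lemma information_cdf_at i :
  measurable_fun setT ((fun w => F i w (Y w)) : g_sigma_algebraType G -> R).
Proof.
apply: (@measurable_cumulative_at _ (g_sigma_algebraType G) R
  (fun w => F i w : cumulative R R)) => [x|].
  exact: measurable_forecast.
exact: measurable_observation.
Qed.

Lemma information_left_lim_at i :
  measurable_fun setT
    ((fun w => left_lim (F i w) (Y w)) : g_sigma_algebraType G -> R).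
Proof.
apply: (@measurable_left_lim_at _ (g_sigma_algebraType G) R
  (fun w => F i w : cumulative R R)) => [x|].
  exact: measurable_forecast.
exact: measurable_observation.
Qed.

Lemma measurable_pit i : measurable_fun setT (Z i).
Proof.
have mg := information_measurable_fun (information_cdf_at i).
have ml := information_measurable_fun (information_left_lim_at i).
apply: measurable_funD => //; apply: measurable_funM => //.
exact: measurable_funB.
Qed.

Lemma pit_Lfun2 i : Z i \in Lfun P 2%:E.
Proof.
apply: (@ae_bounded_Lfun2 _ _ _ P _ 1); first exact: measurable_pit.
apply: filterS (uniform_ae_itv (ps_uniform hps)) => w /andP[V0 V1].
rewrite /Z /pit; set l := left_lim _ _; set g := F i w (Y w).
have l0 : 0 <= l by exact: left_lim_cumulativeBounded_ge.
have lg : 0 <= g - l by rewrite subr_ge0; exact: left_lim_le.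
have g1 : g <= 1 by exact: cumulativeBounded_le.
rewrite ger0_norm; last by rewrite addr_ge0// mulr_ge0.
have : V w * (g - l) <= g - l by rewrite ler_piMl.
lra.
Qed.

(** By regularity the shift vanishes. The difference of the transforms is then
    an affine function of V whose coefficients, the differences of the left
    limits and of the jumps at Y, belong to the information independent of V;
    so both coefficients vanish. *)
Lemma pit_shift_not_visible i j (a : R) :
  regular P Y V (F i) -> regular P Y V (F j) ->
  {ae P, forall w, Z i w = Z j w + a} ->
  P (differ_at Y (F i) (F j)) = 0%E.
Proof.
move=> ri rj Zij.
have a0 : a = 0.
  exact: (regular_shift_eq0 (measurable_pit i) (measurable_pit j) Zij).
pose l i w := left_lim (F i w) (Y w); pose g i w := F i w (Y w).
have ml i' : measurable_fun setT (l i' : g_sigma_algebraType G -> R).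
  exact: information_left_lim_at.
have mg i' : measurable_fun setT (g i' : g_sigma_algebraType G -> R).
  exact: information_cdf_at.
have ae0 : {ae P, forall w, l i w - l j w = 0 /\
    (g i w - l i w) - (g j w - l j w) = 0}.
  apply: (@independent_affine_ae_eq0 _ _ _ P V (ps_uniform hps) G
    (fun w => l i w - l j w) (fun w => (g i w - l i w) - (g j w - l j w))).
  - exact: information_measurable.
  - exact: (ps_independent hps).
  - exact: measurable_funB.
  - by apply: measurable_funB; exact: measurable_funB.
  - apply: filterS Zij => w; rewrite a0 /Z /pit -/(l i w) -/(l j w).
    by rewrite -/(g i w) -/(g j w) => h; lra.
have mne (f h : T -> R) :
    measurable_fun setT (f : g_sigma_algebraType G -> R) ->
    measurable_fun setT (h : g_sigma_algebraType G -> R) ->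
    measurable [set w | f w <> h w].
  move=> mf mh; have mfh : measurable_fun setT (fun w => f w - h w).
    by apply: measurable_funB; exact: information_measurable_fun.
  have -> : [set w | f w <> h w] = (fun w => f w - h w) @^-1` [set~ 0].
    apply/seteqP; split=> w /=; first by move=> fh /subr0_eq.
    by move=> fh fhw; apply: fh; rewrite fhw subrr.
  by rewrite -[X in measurable X]setTI; apply: mfh => //; exact: measurableC.
apply: measure_negligible.
  by apply: measurableU; [exact: (mne (g i) (g j))|exact: (mne (l i) (l j))].
apply: (negligibleS _ ae0) => w [gw|lw] /= [h1 h2].
  by apply: gw; rewrite -/(g i w) -/(g j w); lra.
by apply: lw; rewrite -/(l i w) -/(l j w); lra.
Qed.

Variable c : 'I_k -> R.
Hypothesis c_gt0 : forall i, 0 < c i.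
Hypothesis c_sum1 : \sum_(i < k) c i = 1.
Let pool := linear_pool c (fun i w => F i w : R -> R).

Let pitE : pit Y V pool = \sum_(i < k) c i *: Z i.
Proof. exact: (pit_linear_pool c (fun i w => F i w : cumulative R R)). Qed.

Let weighted_variance_ge0 i :
  0 <= c i * fine 'V_P[(Z i \- pit Y V pool)].
Proof. by rewrite mulr_ge0 ?(ltW (c_gt0 i))// fine_ge0// variance_ge0. Qed.

Let variance_poolE : fine 'V_P[pit Y V pool] =
  \sum_(i < k) c i * fine 'V_P[Z i]
  - \sum_(i < k) c i * fine 'V_P[(Z i \- pit Y V pool)].
Proof.
by rewrite pitE; apply: variance_convex_comb => //; exact: pit_Lfun2.
Qed.

Lemma pool_Lfun2 : pit Y V pool \in Lfun P 2%:E.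
Proof. by rewrite pitE; apply: Lfun2_lincomb; exact: pit_Lfun2. Qed.

Lemma variance_pool_le :
  fine 'V_P[pit Y V pool] <= \sum_(i < k) c i * fine 'V_P[Z i].
Proof. by rewrite variance_poolE gerBl sumr_ge0. Qed.

(** Equality in [variance_pool_le] makes every Z_i - M almost surely constant,
    where M is the transform of the pool, so any two transforms differ by a
    constant. *)
Lemma variance_pool_lt :
  (exists i j, (0 < P (differ_at Y (F i) (F j)))%E) ->
  (forall i, regular P Y V (F i)) ->
  fine 'V_P[pit Y V pool] < \sum_(i < k) c i * fine 'V_P[Z i].
Proof.
move=> [i [j Pij]] reg; rewrite lt_neqAle variance_pool_le andbT.
apply/eqP => eqV; move: Pij; suff -> : P (differ_at Y (F i) (F j)) = 0%E.
  by rewrite ltxx.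
have sum0 : \sum_(i < k) c i * fine 'V_P[(Z i \- pit Y V pool)] = 0.
  by move: variance_poolE; rewrite eqV; lra.
have const h : {ae P, forall w, (Z h \- pit Y V pool) w =
    fine 'E_P[(Z h \- pit Y V pool)]}.
  have ZM2 : (Z h \- pit Y V pool) \in Lfun P 2%:E.
    apply: rpredB => [|p1|p1]; first by rewrite lee1n.
      exact: pit_Lfun2.
    exact: pool_Lfun2.
  apply: variance_eq0_ae => //; rewrite -[LHS]fineK ?variance_fin_num//.
  have /(_ h isT)/eqP := psumr_eq0P (fun i _ => weighted_variance_ge0 i) sum0.
  by rewrite mulf_eq0 gt_eqF//= => /eqP ->.
apply: (@pit_shift_not_visible i j (fine 'E_P[(Z i \- pit Y V pool)] -
  fine 'E_P[(Z j \- pit Y V pool)])) => //.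
by apply: filterS2 (const i) (const j) => w /= <- <-; lra.
Qed.

End prediction_space.

Unset Implicit Arguments.

Theorem theorem3p1 (d : measure_display) (T : measurableType d) (R : realType)
    (P : probability T R) (k : nat) (A : 'I_k -> set (set T))
    (F : 'I_k -> T -> cumulativeBounded (0 : R) (1 : R))
    (Y V : {RV P >-> R}) (c : 'I_k -> R)
    (hk : (2 <= k)%N)
    (hps : prediction_space P A F Y V)
    (hc_gt0 : forall i, 0 < c i)
    (hc_sum : \sum_(i < k) c i = 1)
    (hneq : forall i j, i != j ->
       (0 < P [set w | (F i w : R -> R) <> (F j w : R -> R)])%E) :
  let pool := linear_pool c (fun i w => F i w : R -> R) in
  let max_var := \big[maxe/-oo%E]_(i < k) 'V_P[pit Y V (F i)] in
  let visibly_distinct :=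
    exists i j, (0 < P (differ_at Y (F i) (F j)))%E in
  [/\ ('V_P[pit Y V pool] <= max_var)%E,
      visibly_distinct ->
      (forall i, regular P Y V (F i)) ->
      ('V_P[pit Y V pool] < max_var)%E
    & visibly_distinct ->
      (forall i, neutrally_dispersed P Y V (F i)) ->
      (forall i, regular P Y V (F i)) ->
      overdispersed P Y V pool].
Proof.
move=> pool max_var visibly_distinct.
pose v i := fine 'V_P[pit Y V (F i)].
have vE i : 'V_P[pit Y V (F i)] = (v i)%:E.
  by rewrite fineK// variance_fin_num//; exact: (pit_Lfun2 hps i).
have poolE : 'V_P[pit Y V pool] = (fine 'V_P[pit Y V pool])%:E.
  by rewrite fineK// variance_fin_num//; exact: (pool_Lfun2 hps c).
have mean_le_max : ((\sum_(i < k) c i * v i)%:E <= max_var)%E.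
  case: (arg_maxP v (erefl : xpredT (Ordinal (ltnW hk)))) => i _ vi.
  apply: (@le_trans _ _ (v i)%:E); last first.
    by rewrite -vE; exact: (le_bigmax _ (fun i => 'V_P[pit Y V (F i)]) i).
  rewrite lee_fin -[leRHS]mul1r -hc_sum mulr_suml; apply: ler_sum => j _.
  by rewrite ler_wpM2l ?(ltW (hc_gt0 j))//; exact: vi.
split.
- apply: le_trans mean_le_max; rewrite poolE lee_fin.
  exact: (variance_pool_le hps hc_gt0 hc_sum).
- move=> vis reg; apply: lt_le_trans mean_le_max; rewrite poolE lte_fin.
  exact: (variance_pool_lt hps hc_gt0 hc_sum vis reg).
- move=> vis neutral reg; rewrite /overdispersed poolE lte_fin.
  rewrite (_ : 12%:R^-1 = \sum_(i < k) c i * v i).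
    exact: (variance_pool_lt hps hc_gt0 hc_sum vis reg).
  rewrite -[LHS]mul1r -[X in X * _ = _]hc_sum mulr_suml.
  apply: eq_bigr => i _.
  by congr (_ * _); rewrite /v (neutral i : 'V_P[pit Y V (F i)] = _).
Qed.
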